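(* Let $q$ be a prime power and $f\in\mathbb{N}$ with $2f\le q$. Then for every $r\in[f-1]$, the complete $f$-partite complex $K_{q\times f}$ has a resolvable $K^{(r)}_f$-decomposition.
   Context: $K_{q\times f}$ is the complex with vertex set $V_1\cup\dots\cup V_f$ (disjoint sets, each of size $q$) whose edges are exactly the crossing sets, i.e. sets meeting each $V_i$ in at most one vertex. For $s\in\{0,\dots,f-1\}$, a $K^{(s)}_f$-decomposition of $K_{q\times f}$ can be identified with a collection $Y$ of crossing $f$-sets (transversals) such that every crossing $s$-set is contained in exactly one member of $Y$ (each member $Q$ carrying the complete $s$-graph on $Q$). A $K^{(r)}_f$-decomposition $Y$ is resolvable if $Y$ can be partitioned into sets $Y_1,\dots,Y_t$ such that each $Y_j$ is a $K^{(r-1)}_f$-decomposition of $K_{q\times f}$, i.e. every crossing $(r-1)$-set is contained in exactly one member of $Y_j$. *)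

(* Defs.v *)
From mathcomp Require Import all_boot.

Set Implicit Arguments.
Unset Strict Implicit.
Unset Printing Implicit Defensive.

Definition prime_power (q : nat) : Prop :=
  exists p k : nat, [/\ prime p, 0 < k & q = p ^ k].

Section Complexes.
Variable T : finType.

(* The k-edges $G^{(k)}$ of a complex G, given by its set of edges. *)
Definition level (G : {set {set T}}) (k : nat) : {set {set T}} :=
  [set e in G | #|e| == k].

(* A $K^{(s)}_f$-decomposition of G is encoded by the set Y of the vertex sets
   of its members: each Q in Y is an f-edge of G and stands for the complete
   s-graph on Q, whose edges are the s-subsets of Q. *)
Definition clique_decomposition (f s : nat) (G Y : {set {set T}}) : Prop :=
  Y \subset level G f /\
  forall e, e \in level G s -> exists! Q, Q \in Y /\ e \subset Q.

(* The blocks of [partition] are nonempty; this is no restriction when G has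
   an (r-1)-edge, since then no (r-1)-decomposition of G is empty. *)
Definition resolvable_decomposition (f r : nat) (G Y : {set {set T}}) : Prop :=
  clique_decomposition f r G Y /\
  exists P : {set {set {set T}}},
    partition P Y /\ forall B, B \in P -> clique_decomposition f r.-1 G B.

Definition complete_partite (f : nat) (V : 'I_f -> {set T}) : {set {set T}} :=
  [set e : {set T} | (e \subset \bigcup_i V i)
                     && [forall i, #|e :&: V i| <= 1]].

End Complexes.

(* Main.v *)
(* Reed-Solomon codes. Identify each part V_i with the field F of order q and
   pick distinct points x_i of F. The transversals given by the graphs of the
   polynomials of degree < r form the decomposition, by Lagrange interpolation;
   fixing the coefficient of degree r - 1 splits it into q classes, in each of
   which a polynomial is determined by r - 1 of its values. *)
Require Import Defs.
From mathcomp Require Import all_boot.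
From mathcomp Require Import all_algebra all_field.

Set Implicit Arguments.
Unset Strict Implicit.
Unset Printing Implicit Defensive.

Import GRing.Theory.

Section Interpolation.
Local Open Scope ring_scope.
Variables (F : fieldType) (I : finType) (x : I -> F).
Hypothesis x_inj : injective x.

Lemma interpolation_exists (A : {set I}) (y : I -> F) :
  exists2 p : {poly F}, (size p <= #|A|)%N & {in A, forall i, p.[x i] = y i}.
Proof.
have [n] := ubnP #|A|; elim: n A => // n IH A ltAn.
have [->|[j jA]] := set_0Vmem A.
  by exists 0 => [|i]; rewrite ?size_poly0 // inE.
have [|p sz_p p_y] := IH (A :\ j); first by rewrite (cardsD1 j) jA in ltAn.
(* [w] vanishes at [x i] for every [i] in [A :\ j] but not at [x j], so adding a multiple of it
   corrects the value at [x j] and keeps all the others. *)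
pose w := \prod_(i in A :\ j) ('X - (x i)%:P).
have wj : w.[x j] != 0.
  rewrite horner_prod; apply/prodf_neq0 => i; rewrite !inE => /andP[ij _].
  by rewrite hornerXsubC subr_eq0 (inj_eq x_inj) eq_sym.
have cA : #|A| = #|A :\ j|.+1 by rewrite (cardsD1 j) jA.
exists (p + ((y j - p.[x j]) / w.[x j]) *: w) => [|i iA].
  rewrite cA (leq_trans (size_polyD _ _)) // geq_max (leqW sz_p) /=.
  by rewrite (leq_trans (size_scale_leq _ _)) //
    /w -big_enum size_prod_XsubC -cardE.
rewrite hornerD hornerZ; have [->|ij] := eqVneq i j.
  by rewrite divfK // addrC subrK.
have iAj : i \in A :\ j by rewrite !inE ij.
have -> : w.[x i] = 0.
  by rewrite /w (bigD1 i) //= hornerM hornerXsubC subrr mul0r.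
by rewrite p_y // mulr0 addr0.
Qed.

(** The difference has size at most [#|A|] and [#|A|] distinct roots, hence is zero. *)
Lemma interpolation_unique (A : {set I}) (p1 p2 : {poly F}) :
  (size p1 <= #|A|)%N -> (size p2 <= #|A|)%N ->
  {in A, forall i, p1.[x i] = p2.[x i]} -> p1 = p2.
Proof.
move=> sz1 sz2 eqp; apply/eqP; rewrite -subr_eq0; apply/eqP.
apply: (@roots_geq_poly_eq0 _ _ [seq x i | i <- enum A]).
- apply/allP => _ /mapP[i iA ->]; rewrite mem_enum in iA.
  by rewrite /root hornerD hornerN eqp // subrr.
- by rewrite map_inj_uniq // enum_uniq.
- rewrite size_map -cardE (leq_trans (size_polyD _ _)) //.
  by rewrite geq_max sz1 size_polyN.
Qed.

End Interpolation.

Lemma size_scaleXnD (F : fieldType) s (c : F) (h : {poly F}) :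
  size h <= s -> size (c *: 'X^s + h)%R <= s.+1.
Proof.
move=> sz_h; rewrite (leq_trans (size_polyD _ _)) // geq_max (leqW sz_h) andbT.
by rewrite (leq_trans (size_scale_leq _ _)) // size_polyXn.
Qed.

Section ReedSolomon.
Local Open Scope ring_scope.
Variables (F : finFieldType) (T : finType) (f : nat).
Variables (x : 'I_f -> F) (V : 'I_f -> {set T}) (v : 'I_f -> F -> T).
Hypothesis x_inj : injective x.
Hypothesis V_im : forall i, V i = v i @: [set: F].
Hypothesis v_inj : forall i j a b, v i a = v j b -> i = j /\ a = b.

Local Notation K := (complete_partite V).

(** The index set [A] may be proper, so that crossing sets of every size take this form; [A = setT]
    gives the full transversals. *)
Definition transversal_of (y : 'I_f -> F) (A : {set 'I_f}) : {set T} :=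
  [set v i (y i) | i in A].

Lemma card_transversal_of y A : #|transversal_of y A| = #|A|.
Proof. by apply: card_imset => i j /v_inj[]. Qed.

Lemma mem_transversal_of y A i a :
  (v i a \in transversal_of y A) = (i \in A) && (a == y i).
Proof.
apply/imsetP/andP => [[j jA /v_inj[-> ->]]|[iA /eqP->]]; first by rewrite eqxx.
by exists i.
Qed.

Lemma transversal_of_crossing y A : transversal_of y A \in K.
Proof.
rewrite inE; apply/andP; split.
  apply/subsetP => _ /imsetP[i iA ->]; apply/bigcupP; exists i => //.
  by rewrite V_im imset_f.
apply/forallP => i; rewrite -(cards1 (v i (y i))) subset_leq_card //.
apply/subsetP => u; rewrite V_im !inE => /andP[uy /imsetP[a _ ua]].
by move: uy; rewrite ua mem_transversal_of => /andP[_ /eqP->].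
Qed.

Lemma crossing_transversal_of e :
  e \in K -> exists A y, e = transversal_of y A.
Proof.
rewrite inE => /andP[/subsetP eV /forallP e1].
exists [set i | [exists a, v i a \in e]].
(* The default 0 is harmless: it occurs only at indices of parts that [e] misses, and these lie
   outside the chosen index set. *)
exists (fun i => odflt 0 [pick a | v i a \in e]).
apply/setP => u; apply/idP/imsetP => [ue|[i]].
  have /bigcupP[i _] := eV _ ue; rewrite V_im => /imsetP[a _ ua]; subst u.
  exists i; first by rewrite inE; apply/existsP; exists a.
  case: pickP => [b be|/(_ a)]; last by rewrite ue.
  apply: (card_le1_eqP (e1 i)); rewrite inE V_im ?imset_f ?andbT //.
rewrite inE => /existsP[a ae] ->.
by case: pickP => // /(_ a); rewrite ae.
Qed.

Definition codeword (p : {poly F}) : {set T} :=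
  transversal_of (fun i => p.[x i]) setT.

(** Turns containment of edges into an interpolation condition. *)
Lemma transversal_of_sub_codeword y (A : {set 'I_f}) p :
  reflect {in A, forall i, p.[x i] = y i}
          (transversal_of y A \subset codeword p).
Proof.
apply: (iffP subsetP) => [sub i iA|py u /imsetP[i iA ->]]; last first.
  by rewrite mem_transversal_of inE py //=.
have /sub : v i (y i) \in transversal_of y A by rewrite imset_f.
by rewrite mem_transversal_of inE => /eqP.
Qed.

Lemma codeword_inj (p1 p2 : {poly F}) :
  (size p1 <= f)%N -> (size p2 <= f)%N -> codeword p1 = codeword p2 -> p1 = p2.
Proof.
move=> sz1 sz2 eqc.
apply: (interpolation_unique x_inj (A := setT)); rewrite ?cardsT ?card_ord //.
by apply/transversal_of_sub_codeword; rewrite -/(codeword p2) eqc.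
Qed.

(** A translate of a Reed-Solomon code. The offset [g] lets one definition cover both the whole
    decomposition and its classes; row vectors make the family of polynomials of size at most [s] a
    finite type. *)
Definition code (g : {poly F}) (s : nat) : {set {set T}} :=
  [set codeword (g + rVpoly u) | u : 'rV[F]_s].

Lemma codeP g s Q :
  reflect (exists2 h : {poly F}, (size h <= s)%N & Q = codeword (g + h))
          (Q \in code g s).
Proof.
apply: (iffP imsetP) => [[u _ ->]|[h sz_h ->]].
  by exists (rVpoly u) => //; apply: size_poly.
by exists (poly_rV h); rewrite ?poly_rV_K.
Qed.

(** A crossing [s]-set prescribes [s] values of [g + h], that is, [s] values of [h], and
    interpolation yields exactly one [h] of size at most [s]. *)
Lemma code_decomposition g s : clique_decomposition f s K (code g s).
Proof.
split=> [|e].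
  apply/subsetP => _ /codeP[h _ ->].
  by rewrite inE transversal_of_crossing card_transversal_of cardsT card_ord /=.
rewrite inE => /andP[/crossing_transversal_of[A [y ->]]].
rewrite card_transversal_of => /eqP cA.
have [h sz_h hy] := interpolation_exists x_inj A (fun i => y i - g.[x i]).
exists (codeword (g + h)); split=> [|_ [/codeP[h' sz_h' ->]]].
  split; first by apply/codeP; exists h; rewrite -?cA.
  by apply/transversal_of_sub_codeword => i iA; rewrite hornerD hy // addrC subrK.
move/transversal_of_sub_codeword => h'y; congr (codeword (g + _)).
apply: (interpolation_unique x_inj sz_h); rewrite ?cA // => i iA.
by rewrite hy // -h'y // hornerD addrC addKr.
Qed.

Lemma code_resolvable s :
  (s < f)%N -> resolvable_decomposition f s.+1 K (code 0 s.+1).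
Proof.
move=> lt_sf; split; first exact: code_decomposition.
exists [set code (c *: 'X^s) s | c : F]; split; last first.
  by move=> _ /imsetP[c _ ->]; apply: code_decomposition.
apply/and3P; split.
- apply/eqP/setP => Q; apply/bigcupP/codeP => [[_ /imsetP[c _ ->]]|[h sz_h ->]].
    case/codeP => h sz_h ->; exists (c *: 'X^s + h); last by rewrite add0r.
    exact: size_scaleXnD.
  (* The class of [h] is read off its coefficient of degree [s]; removing that term leaves size at
     most [s]. *)
  exists (code (h`_s *: 'X^s) s); first exact: imset_f.
  apply/codeP; exists (h - h`_s *: 'X^s); last by rewrite add0r addrC subrK.
  apply/leq_sizeP => i le_si; rewrite coefB coefZ coefXn.
  move: le_si; rewrite leq_eqVlt => /predU1P[<-|lt_si].
    by rewrite eqxx mulr1 subrr.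
  by rewrite (leq_sizeP _ _ sz_h i lt_si) gtn_eqF // mulr0 subrr.
(* If two classes share a codeword, the two polynomials coincide because their sizes are at most
   [s.+1 <= f]; comparing coefficients of degree [s] gives [c = d]. *)
- apply/trivIsetP => _ _ /imsetP[c _ ->] /imsetP[d _ ->]; apply: contraR.
  case/pred0Pn => Q /andP[/codeP[h sz_h ->] /codeP[k sz_k]].
  move/codeword_inj; rewrite !(leq_trans (size_scaleXnD _ _) lt_sf) //.
  move=> /(_ isT isT) /(congr1 (fun p : {poly F} => p`_s)).
  rewrite !coefD !coefZ !coefXn eqxx !mulr1.
  by rewrite (leq_sizeP _ _ sz_h) // (leq_sizeP _ _ sz_k) // !addr0 => ->.
(* No class is empty: it contains the codeword of [c *: 'X^s]. *)
- apply/imsetP => [[c _ /setP/(_ (codeword (c *: 'X^s + 0)))]].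
  rewrite inE => /esym/codeP[]; by exists 0; rewrite ?size_poly0.
Qed.

End ReedSolomon.

(** Used to label the points of each part by the elements of the field. *)
Lemma imset_enum_of_card (S T : finType) (A : {set T}) :
  #|A| = #|S| -> exists2 g : S -> T, injective g & A = g @: [set: S].
Proof.
move=> cA; pose g y := enum_val (cast_ord (esym cA) (enum_rank y)).
have g_inj : injective g.
  by move=> y z /enum_val_inj /cast_ord_inj /enum_rank_inj.
exists g => //; apply/esym/eqP; rewrite eqEcard card_imset // cardsT cA leqnn.
by rewrite andbT; apply/subsetP => _ /imsetP[y _ ->]; apply: enum_valP.
Qed.

Theorem theorem8p1 (q f : nat) (hq : prime_power q) (hf : 2 * f <= q)
    (T : finType) (V : 'I_f -> {set T})
    (cardV : forall i, #|V i| = q)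
    (disjV : forall i j, i != j -> [disjoint V i & V j])
    (r : nat) (hr : 1 <= r <= f - 1) :
  exists Y : {set {set T}}, resolvable_decomposition f r (complete_partite V) Y.
Proof.
case: hq => p [k [p_pr k_gt0 qE]].
have [F _ cF] := PrimePowerField p_pr k_gt0; rewrite -qE in cF.
have cV i : #|V i| = #|F| by rewrite cardV cF.
have /fin_all_exists2[v v_inj V_im] i := imset_enum_of_card (cV i).
(* The bound on [f] enters here: the field has at least [f] elements, which provides [f] distinct
   evaluation points. *)
have le_fF : f <= #|F| by rewrite cF (leq_trans _ hf) // leq_pmull.
pose x i : F := enum_val (widen_ord le_fF i).
have x_inj : injective x.
  by move=> i j /enum_val_inj[] /val_inj.
have v_inj2 i j a b : v i a = v j b -> i = j /\ a = b.
  have [->|ij vv] := eqVneq i j; first by move/v_inj.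
  by have /pred0P/(_ (v i a)) := disjV i j ij;
    rewrite /= [in X in _ && X]vv !V_im !imset_f.
case: r hr => // s /= hs.
exists (code x v 0%R s.+1); apply: code_resolvable => //.
by rewrite (leq_trans hs) // leq_subr.
Qed.
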